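(* Let $E$ be a finite-dimensional vector space over a field and let $\mathcal{F}\subseteq\mathcal{L}(E)$ satisfy the flat axioms (F1)–(F3). Define $\mathrm{cl}_{\mathcal{F}}:\mathcal{L}(E)\to\mathcal{L}(E)$ by $\mathrm{cl}_{\mathcal{F}}(A):=\bigcap\{F\in\mathcal{F}: A\subseteq F\}$. Then $\mathrm{cl}_{\mathcal{F}}$ satisfies the closure axioms (Cl1)–(Cl4).
   Context: $\mathcal{L}(E)$ is the lattice of subspaces of $E$. For $A,B\in\mathcal{F}$, $B$ covers $A$ in $\mathcal{F}$ if $A\subseteq B$ and every $C\in\mathcal{F}$ with $A\subseteq C\subseteq B$ equals $A$ or $B$. Flat axioms: (F1) $E\in\mathcal{F}$; (F2) $F_1\cap F_2\in\mathcal{F}$ for $F_1,F_2\in\mathcal{F}$; (F3) for every $F\in\mathcal{F}$ and $1$-dimensional $x\not\subseteq F$ there is a unique cover of $F$ in $\mathcal{F}$ containing $x$. Closure axioms for a map $\mathrm{cl}$: (Cl1) $A\subseteq\mathrm{cl}(A)$; (Cl2) $A\subseteq B\Rightarrow\mathrm{cl}(A)\subseteq\mathrm{cl}(B)$; (Cl3) $\mathrm{cl}(\mathrm{cl}(A))=\mathrm{cl}(A)$; (Cl4) for all subspaces $A$ and $1$-dimensional $x,y$, if $y\subseteq\mathrm{cl}(A+x)$ and $y\not\subseteq\mathrm{cl}(A)$ then $x\subseteq\mathrm{cl}(A+y)$. *)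

(* Defs.v *)
From HB Require Import structures.
From mathcomp Require Import all_boot all_algebra.
From mathcomp Require Import boolp classical_sets.

Set Implicit Arguments.
Unset Strict Implicit.
Unset Printing Implicit Defensive.

Import GRing.Theory.

Section QFlats.
Variables (K : fieldType) (E : vectType K).
Implicit Types (A B C U V x y : {vspace E}) (S Fl : set {vspace E}).
Implicit Type cl : {vspace E} -> {vspace E}.

(* A family S may be infinite, so its intersection is not a MathComp \bigcap; *)
(* it is a (detachable) {vspace E} because, by finite dimension, it equals a  *)
(* finite sub-intersection of least dimension.                                *)
Lemma capv_family_ex S :
  exists U : {vspace E}, forall v : E, v \in U <-> (forall V, S V -> v \in V).
Proof.
pose good U := exists2 s : seq {vspace E},
  (forall V, V \in s -> S V) & U = (\bigcap_(V <- s) V)%VS.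
pose P n := `[< exists2 U, good U & \dim U = n >].
have exP : exists n, P n.
  exists (\dim {:E}); apply/asboolP; exists fullv => //.
  by exists [::] => //; rewrite big_nil.
case: (ex_minnP exP) => n /asboolP[U [s sS defU] dimU] minU.
exists U => v; split=> [Uv V SV | inS]; last first.
  rewrite defU; elim: s sS {defU} => [|V s IHs] sS.
    by rewrite big_nil memvf.
  rewrite big_cons memv_cap inS ?IHs //; last by apply: sS; rewrite mem_head.
  by move=> W sW; apply: sS; rewrite inE sW orbT.
suff defVU : (V :&: U)%VS = U by move: Uv; rewrite -defVU memv_cap => /andP[].
apply/eqP; rewrite eqEdim capvSr dimU /=; apply: minU; apply/asboolP.
exists (V :&: U)%VS => //; exists (V :: s); last by rewrite big_cons defU.
by move=> W; rewrite inE => /predU1P[-> // | /sS].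
Qed.

Definition capv_family S : {vspace E} := projT1 (cid (capv_family_ex S)).

Lemma mem_capv_family S (v : E) :
  v \in capv_family S <-> (forall V, S V -> v \in V).
Proof. exact: (projT2 (cid (capv_family_ex S)) v). Qed.

(* B covers A. A flat covers itself here; in flat_axioms the cover of A is   *)
(* proper anyway, since it contains x and A does not.                         *)
Definition covers Fl A B : Prop :=
  [/\ Fl A, Fl B, (A <= B)%VS
    & forall C, Fl C -> (A <= C)%VS -> (C <= B)%VS -> C = A \/ C = B].

Definition flat_axioms Fl : Prop :=
  [/\ Fl fullv,
      forall A B, Fl A -> Fl B -> Fl (A :&: B)%VS
    & forall A x, Fl A -> \dim x = 1 -> ~~ (x <= A)%VS ->
        exists! B, covers Fl A B /\ (x <= B)%VS].

Definition closure_axioms cl : Prop :=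
  [/\ forall A, (A <= cl A)%VS,
      forall A B, (A <= B)%VS -> (cl A <= cl B)%VS,
      forall A, cl (cl A) = cl A
    & forall A x y, \dim x = 1 -> \dim y = 1 ->
        (y <= cl (A + x))%VS -> ~~ (y <= cl A)%VS -> (x <= cl (A + y))%VS].

Definition flat_closure Fl A : {vspace E} :=
  capv_family [set F | Fl F /\ (A <= F)%VS].

End QFlats.

(* Main.v *)
(** Let [F = cl A], which is a flat, and let [B] be a cover of [F] containing
    [x].  Then [cl (A + x) <= B], so [y <= B].  The flat [cl (A + y)] lies
    between [F] and [B] and differs from [F] because it contains [y]; hence it
    is [B], which contains [x]. *)
Require Import Defs.
From HB Require Import structures.
From mathcomp Require Import all_boot all_algebra.
From mathcomp Require Import boolp classical_sets.

Lemma flat_closure_sub (K : fieldType) (E : vectType K) (Fl : set {vspace E})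
  (A F : {vspace E}) : Fl F -> (A <= F)%VS -> (flat_closure Fl A <= F)%VS.
Proof.
by move=> FlF AF; apply/subvP => v /mem_capv_family clv; apply: clv.
Qed.

Lemma sub_flat_closure (K : fieldType) (E : vectType K) (Fl : set {vspace E})
  (A : {vspace E}) : (A <= flat_closure Fl A)%VS.
Proof.
apply/subvP => v Av; apply/mem_capv_family => F [_ AF].
exact: (subvP AF).
Qed.

(* A flat of least dimension above [A] lies in every flat above [A], so (F2)
   suffices although the intersection defining the closure may be infinite. *)
Lemma flat_closure_flat (K : fieldType) (E : vectType K)
    (Fl : set {vspace E}) (A : {vspace E}) :
  flat_axioms Fl -> Fl (flat_closure Fl A).
Proof.
case=> FlE FlI _.
pose P n := `[< exists F, [/\ Fl F, (A <= F)%VS & \dim F = n] >].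
have exP : exists n, P n.
  by exists (\dim {:E}); apply/asboolP; exists fullv; split; rewrite ?subvf.
case: (ex_minnP exP) => n /asboolP[F [FlF AF dimF]] minF.
suff -> : flat_closure Fl A = F by [].
apply/eqP; rewrite eqEsubv flat_closure_sub //=.
apply/subvP => v Fv; apply/mem_capv_family => G [FlG AG].
(* [G :&: F] is a flat above [A] inside [F], so minimality of [\dim F] leaves it no room to be
   smaller. *)
suff defF : (G :&: F)%VS = F by move: Fv; rewrite -defF memv_cap => /andP[].
apply/eqP; rewrite eqEdim capvSr dimF /=; apply: minF; apply/asboolP.
by exists (G :&: F)%VS; split; rewrite ?subv_cap ?AG //; apply: FlI.
Qed.

Theorem theorem42 (K : fieldType) (E : vectType K) (Fl : set {vspace E})
  (hFl : flat_axioms Fl) : closure_axioms (flat_closure Fl).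
Proof.
have clFl A : Fl (flat_closure Fl A) by exact: flat_closure_flat.
have clS A B : (A <= B)%VS -> (flat_closure Fl A <= flat_closure Fl B)%VS.
  move=> AB; apply: flat_closure_sub => //.
  exact: subv_trans AB (sub_flat_closure _ _ _ _).
split=> // [A|A|A x y dimx _ yAx yA].
- exact: sub_flat_closure.
(* Being a flat, [flat_closure Fl A] belongs to the family intersected to form its own closure. *)
- by apply/eqP; rewrite eqEsubv sub_flat_closure flat_closure_sub ?subvv.
(* Otherwise the flat [flat_closure Fl A] would contain [A + x], hence its closure and with it [y].
   So (F3) applies to this flat and [x]. *)
have xA : ~~ (x <= flat_closure Fl A)%VS.
  apply: contra yA => xA; apply: subv_trans yAx _.
  by apply: flat_closure_sub; rewrite // subv_add sub_flat_closure.
case: hFl => _ _ /(_ _ _ (clFl A) dimx xA)[B [[[_ FlB AB minB] xB] _]].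
have yB : (y <= B)%VS.
  apply: subv_trans yAx _; apply: flat_closure_sub => //.
  by rewrite subv_add xB (subv_trans (sub_flat_closure _ _ _ _) AB).
have [||defA|-> //] := minB _ (clFl (A + y)%VS).
- exact/clS/addvSl.
- apply: flat_closure_sub => //.
  by rewrite subv_add yB (subv_trans (sub_flat_closure _ _ _ _) AB).
by rewrite -defA (subv_trans (addvSr A y) (sub_flat_closure _ _ _ _)) in yA.
Qed.
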